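(* Let $S,T$ be as in the context. If $\mathrm{Pr}_T(x)$ is a $\Sigma_1$ provability predicate of $T$ satisfying $\mathbf{CB}$, then $T\nvdash\mathrm{RFN}_T(\Delta_0)$.
   Context: $\mathcal{L}_A=\{0,\mathsf{s},+,\times,\leq\}$ is the language of first-order arithmetic, and ''formula'' means $\mathcal{L}_A$-formula; $\ulcorner\varphi\urcorner$ is the numeral of the Gödel number of $\varphi$. $S$ and $T$ are consistent c.e. extensions of Peano Arithmetic $\mathsf{PA}$ in the language $\mathcal{L}_A$ such that $T$ is stronger than $S$ (every theorem of $S$ is a theorem of $T$; $S=T$ is allowed). A formula $\mathrm{Pr}_T(x)$ is a provability predicate of $T$ if for every formula $\varphi$: $T\vdash\varphi$ if and only if $S\vdash\mathrm{Pr}_T(\ulcorner\varphi\urcorner)$. A $\Sigma_1$ provability predicate is one that is a $\Sigma_1$ formula. $\ulcorner\varphi(\vec{\dot{x}})\urcorner$ is a term with free variables $\vec{x}$ for the primitive recursive function that computes from $\vec{n}$ the Gödel number of $\varphi(\overline{\vec{n}})$, the result of substituting the numerals of $\vec{n}$ for $\vec{x}$ in $\varphi(\vec{x})$. $\mathbf{CB}$: $S\vdash\mathrm{Pr}_T(\ulcorner\forall\vec{x}\,\varphi(\vec{x})\urcorner)\to\forall\vec{x}\,\mathrm{Pr}_T(\ulcorner\varphi(\vec{\dot{x}})\urcorner)$ for every formula $\varphi(\vec{x})$. $\mathrm{RFN}_T(\Delta_0)$ is the set $\{\forall\vec{x}\,(\mathrm{Pr}_T(\ulcorner\varphi(\vec{\dot{x}})\urcorner)\to\varphi(\vec{x}))\mid\varphi(\vec{x})\text{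 is a }\Delta_0\text{ formula}\}$; $T\nvdash\mathrm{RFN}_T(\Delta_0)$ means that $T$ fails to prove at least one member of this set. *)

(* Defs.v *)
From Stdlib Require List.
From mathcomp Require Import all_boot.
Set Implicit Arguments.
Unset Strict Implicit.
Unset Printing Implicit Defensive.

Inductive term : Type :=
| Var of nat
| Zero
| Succ of term
| Add of term & term
| Mul of term & term.

Inductive formula : Type :=
| Bot
| Eq of term & term
| Le of term & term
| Imp of formula & formula
| And of formula & formula
| Or of formula & formula
| All of formula
| Ex of formula.

Definition Neg (A : formula) := Imp A Bot.
Definition Iff (A B : formula) := And (Imp A B) (Imp B A).

Fixpoint tsubst (s : nat -> term) (t : term) : term :=
  match t with
  | Var i => s i
  | Zero => Zero
  | Succ t => Succ (tsubst s t)
  | Add t u => Add (tsubst s t) (tsubst s u)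
  | Mul t u => Mul (tsubst s t) (tsubst s u)
  end.

Definition scons (t : term) (s : nat -> term) (i : nat) : term :=
  if i is j.+1 then s j else t.

Definition tlift : term -> term := tsubst (fun i => Var i.+1).

Fixpoint subst (s : nat -> term) (A : formula) : formula :=
  let up := scons (Var 0) (fun i => tlift (s i)) in
  match A with
  | Bot => Bot
  | Eq t u => Eq (tsubst s t) (tsubst s u)
  | Le t u => Le (tsubst s t) (tsubst s u)
  | Imp A B => Imp (subst s A) (subst s B)
  | And A B => And (subst s A) (subst s B)
  | Or A B => Or (subst s A) (subst s B)
  | All A => All (subst up A)
  | Ex A => Ex (subst up A)
  end.

Definition lift : formula -> formula := subst (fun i => Var i.+1).

(* [inst A t]: instantiate index 0 of [A] by [t] and lower the other indices;
   this is A(t) when A has a single free variable. *)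
Definition inst (A : formula) (t : term) : formula := subst (scons t Var) A.

(* [bounded n A]: the free variables of [A] are among the indices 0, ..., n-1. *)
Fixpoint tbounded (n : nat) (t : term) : bool :=
  match t with
  | Var i => i < n
  | Zero => true
  | Succ t => tbounded n t
  | Add t u | Mul t u => tbounded n t && tbounded n u
  end.

Fixpoint bounded (n : nat) (A : formula) : bool :=
  match A with
  | Bot => true
  | Eq t u | Le t u => tbounded n t && tbounded n u
  | Imp A B | And A B | Or A B => bounded n A && bounded n B
  | All A | Ex A => bounded n.+1 A
  end.

Definition sentence (A : formula) : bool := bounded 0 A.

Definition AllN (n : nat) (A : formula) : formula := iter n All A.
Definition ExN (n : nat) (A : formula) : formula := iter n Ex A.

Definition AllLe (t : term) (A : formula) := All (Imp (Le (Var 0) (tlift t)) A).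
Definition ExLe (t : term) (A : formula) := Ex (And (Le (Var 0) (tlift t)) A).

Inductive Delta0 : formula -> Prop :=
| Delta0_Bot : Delta0 Bot
| Delta0_Eq t u : Delta0 (Eq t u)
| Delta0_Le t u : Delta0 (Le t u)
| Delta0_Imp A B : Delta0 A -> Delta0 B -> Delta0 (Imp A B)
| Delta0_And A B : Delta0 A -> Delta0 B -> Delta0 (And A B)
| Delta0_Or A B : Delta0 A -> Delta0 B -> Delta0 (Or A B)
| Delta0_AllLe t A : Delta0 A -> Delta0 (AllLe t A)
| Delta0_ExLe t A : Delta0 A -> Delta0 (ExLe t A).

Definition Sigma1 (A : formula) : Prop :=
  exists n B, Delta0 B /\ A = ExN n B.

Inductive nd : list formula -> formula -> Prop :=
| nd_hyp G A : List.In A G -> nd G A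
| nd_raa G A : nd (Neg A :: G) Bot -> nd G A
| nd_impI G A B : nd (A :: G) B -> nd G (Imp A B)
| nd_impE G A B : nd G (Imp A B) -> nd G A -> nd G B
| nd_andI G A B : nd G A -> nd G B -> nd G (And A B)
| nd_andE1 G A B : nd G (And A B) -> nd G A
| nd_andE2 G A B : nd G (And A B) -> nd G B
| nd_orI1 G A B : nd G A -> nd G (Or A B)
| nd_orI2 G A B : nd G B -> nd G (Or A B)
| nd_orE G A B C : nd G (Or A B) -> nd (A :: G) C -> nd (B :: G) C -> nd G C
| nd_allI G A : nd (map lift G) A -> nd G (All A)
| nd_allE G A t : nd G (All A) -> nd G (inst A t)
| nd_exI G A t : nd G (inst A t) -> nd G (Ex A)
| nd_exE G A C : nd G (Ex A) -> nd (A :: map lift G) (lift C) -> nd G C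
| nd_refl G t : nd G (Eq t t)
| nd_eq G A t u : nd G (Eq t u) -> nd G (inst A t) -> nd G (inst A u).

(* A theory is given by its set of nonlogical axioms. *)
Definition theory := formula -> Prop.

Definition proves (T : theory) (A : formula) : Prop :=
  exists G, (forall B, List.In B G -> T B) /\ nd G A.

Definition consistent (T : theory) : Prop := ~ proves T Bot.

Definition extends (T S : theory) : Prop :=
  forall A, proves S A -> proves T A.

Inductive PA : theory :=
| PA_succ_neq0 : PA (All (Neg (Eq (Succ (Var 0)) Zero)))
| PA_succ_inj :
    PA (All (All (Imp (Eq (Succ (Var 1)) (Succ (Var 0))) (Eq (Var 1) (Var 0)))))
| PA_add0 : PA (All (Eq (Add (Var 0) Zero) (Var 0)))
| PA_addS :
    PA (All (All (Eq (Add (Var 1) (Succ (Var 0))) (Succ (Add (Var 1) (Var 0))))))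
| PA_mul0 : PA (All (Eq (Mul (Var 0) Zero) Zero))
| PA_mulS :
    PA (All (All (Eq (Mul (Var 1) (Succ (Var 0)))
                     (Add (Mul (Var 1) (Var 0)) (Var 1)))))
| PA_le :
    PA (All (All (Iff (Le (Var 1) (Var 0)) (Ex (Eq (Add (Var 2) (Var 0)) (Var 1))))))
| PA_induction n A : bounded n.+1 A ->
    PA (AllN n (Imp (inst A Zero)
               (Imp (All (Imp A (subst (scons (Succ (Var 0)) (fun i => Var i.+1)) A)))
                    (All A)))).

(* Shoenfield-style injective pairing; being a polynomial with coefficients in
   the naturals, it is also given by a term of the language ([tpair]). *)
Definition pairn (a b : nat) : nat := (a + b) * (a + b) + a.
Definition tpair (a b : term) : term := Add (Mul (Add a b) (Add a b)) a.

Fixpoint tgn (t : term) : nat :=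
  match t with
  | Var i => pairn 0 i
  | Zero => pairn 1 0
  | Succ t => pairn 2 (tgn t)
  | Add t u => pairn 3 (pairn (tgn t) (tgn u))
  | Mul t u => pairn 4 (pairn (tgn t) (tgn u))
  end.

Fixpoint gn (A : formula) : nat :=
  match A with
  | Bot => pairn 0 0
  | Eq t u => pairn 1 (pairn (tgn t) (tgn u))
  | Le t u => pairn 2 (pairn (tgn t) (tgn u))
  | Imp A B => pairn 3 (pairn (gn A) (gn B))
  | And A B => pairn 4 (pairn (gn A) (gn B))
  | Or A B => pairn 5 (pairn (gn A) (gn B))
  | All A => pairn 6 (gn A)
  | Ex A => pairn 7 (gn A)
  end.

Definition numeral (n : nat) : term := iter n Succ Zero.

Definition quote (A : formula) : term := numeral (gn A).

Inductive recfun : nat -> Type :=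
| RZero n : recfun n
| RSucc : recfun 1
| RProj n : 'I_n -> recfun n
| RComp m n : recfun m -> ('I_m -> recfun n) -> recfun n
| RPrim n : recfun n -> recfun n.+2 -> recfun n.+1
| RMin n : recfun n.+1 -> recfun n.

(* [computes f x y]: the partial recursive function [f] is defined at [x], with
   value [y]. Primitive recursion is on the first argument, with the step
   function taking (counter, previous value, parameters). *)
Fixpoint computes (n : nat) (f : recfun n) : n.-tuple nat -> nat -> Prop :=
  match f in recfun n return n.-tuple nat -> nat -> Prop with
  | RZero _ => fun _ y => y = 0
  | RSucc => fun x y => y = (thead x).+1
  | RProj _ i => fun x y => y = tnth x i
  | RComp m _ f g => fun x y =>
      exists z : m.-tuple nat,
        (forall i, computes (g i) x (tnth z i)) /\ computes f z y
  | RPrim _ f g => fun x y =>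
      exists v : nat -> nat,
        [/\ computes f [tuple of behead x] (v 0),
            forall i, i < thead x ->
              computes g [tuple of i :: v i :: behead x] (v i.+1)
          & y = v (thead x)]
  | RMin _ f => fun x y =>
      computes f [tuple of y :: x] 0 /\
      forall i, i < y -> exists z, computes f [tuple of i :: x] z.+1
  end.

Definition ce (X : nat -> Prop) : Prop :=
  exists f : recfun 1, forall m, X m <-> exists y, computes f [tuple m] y.

Definition ce_theory (T : theory) : Prop :=
  ce (fun m => exists A, T A /\ gn A = m).

Definition consistent_ce_extension_of_PA (T : theory) : Prop :=
  [/\ forall A, T A -> sentence A, consistent T, ce_theory T & extends T PA].

(* Goedel's beta function: r is the remainder of a modulo 1 + (i + 1) * b. *)
Definition beta (a b i r : term) : formula :=
  And (Le r (Mul (Succ i) b))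
      (ExLe a (Eq (tlift a)
                  (Add (Mul (Var 0) (Succ (Mul (Succ (tlift i)) (tlift b))))
                       (tlift r)))).

(* Graph of the primitive recursive function n |-> tgn (numeral n), with
   argument the variable 0 and value the variable 1: there is a sequence coded
   by (a, b) with entry 0 equal to tgn Zero, with entry i + 1 equal to
   tgn (Succ t) if entry i is tgn t, and whose entry of index n is the value. *)
Definition num_graph : formula :=
  let a := 1 in let b := 0 in let n := 2 in let u := 3 in
  Ex (Ex (And (beta (Var a) (Var b) Zero (numeral (tgn Zero)))
         (And (AllLe (Var n) (Imp (Le (Succ (Var 0)) (Var n.+1))
                 (ExLe (Var a.+1)
                   (And (beta (Var a.+2) (Var b.+2) (Var 1) (Var 0))
                        (beta (Var a.+2) (Var b.+2) (Succ (Var 1))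
                              (tpair (numeral 2) (Var 0)))))))
              (beta (Var a) (Var b) (Var n) (Var u))))).

Definition num_graph_at (x u : term) : formula :=
  subst (scons x (scons u Var)) num_graph.

(* [code_tm k t] and [code_fm k A] compute the Goedel number of the result of
   replacing in [t], resp. [A], the free variable of index i (counted outside
   the k enclosing quantifiers) by the closed term whose Goedel number is the
   value of [Var i]. *)
Fixpoint code_tm (k : nat) (t : term) : term :=
  match t with
  | Var i => if i < k then numeral (tgn (Var i)) else Var (i - k)
  | Zero => numeral (tgn Zero)
  | Succ t => tpair (numeral 2) (code_tm k t)
  | Add t u => tpair (numeral 3) (tpair (code_tm k t) (code_tm k u))
  | Mul t u => tpair (numeral 4) (tpair (code_tm k t) (code_tm k u))
  end.

Fixpoint code_fm (k : nat) (A : formula) : term :=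
  match A with
  | Bot => numeral (gn Bot)
  | Eq t u => tpair (numeral 1) (tpair (code_tm k t) (code_tm k u))
  | Le t u => tpair (numeral 2) (tpair (code_tm k t) (code_tm k u))
  | Imp A B => tpair (numeral 3) (tpair (code_fm k A) (code_fm k B))
  | And A B => tpair (numeral 4) (tpair (code_fm k A) (code_fm k B))
  | Or A B => tpair (numeral 5) (tpair (code_fm k A) (code_fm k B))
  | All A => tpair (numeral 6) (code_fm k.+1 A)
  | Ex A => tpair (numeral 7) (code_fm k.+1 A)
  end.

(* Graph of (x_0, ..., x_(n-1)) |-> gn (A(x_0, ..., x_(n-1))), the x_i being
   replaced in A by their numerals. The value is the variable 0 and the
   argument x_i is the variable i + 1; the n quantified variables are the
   Goedel numbers of the numerals of the x_i. *)
Definition dot_graph (n : nat) (A : formula) : formula :=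
  ExN n (foldr And (Eq (Var n) (code_fm 0 A))
               [seq num_graph_at (Var (n + i).+1) (Var i) | i <- iota 0 n]).

(* P applied to the term for the function of [dot_graph]: this function symbol
   is not in the language, and is eliminated through its graph. The free
   variables are those indexed by 0, ..., n-1, as in A. *)
Definition at_dot (P : formula) (n : nat) (A : formula) : formula :=
  Ex (And (dot_graph n A) (inst P (Var 0))).

Definition provability_predicate (S T : theory) (Pr : formula) : Prop :=
  bounded 1 Pr /\
  forall A : formula, proves T A <-> proves S (inst Pr (quote A)).

Definition CB (S : theory) (Pr : formula) : Prop :=
  forall (n : nat) (A : formula), bounded n A ->
    proves S (Imp (inst Pr (quote (AllN n A))) (AllN n (at_dot Pr n A))).

Definition RFN_Delta0 (Pr : formula) : theory := fun C =>
  exists (n : nat) (A : formula),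
    [/\ bounded n A, Delta0 A & C = AllN n (Imp (at_dot Pr n A) A)].

(* Main.v *)
From Stdlib Require List.
From mathcomp Require Import all_boot zify.
Require Import Defs.
Set Implicit Arguments.
Unset Strict Implicit.
Unset Printing Implicit Defensive.

(* Write Pr = exists ys, B with B in Delta0. The Pi1 formula forall ys, ~ B has
   a fixed point that is literally a universal closure forall xs, M of a Delta0
   formula M. By CB, Pr(forall xs, M) gives forall xs, Pr(M(xs)), from which
   RFN(Delta0) would give forall xs, M itself. As forall xs, M is equivalent to
   ~ Pr(forall xs, M), the theory T would prove ~ Pr(forall xs, M), hence
   forall xs, M; but then S, and so T, proves Pr(forall xs, M). *)

(** * Substitution *)

Definition up (s : nat -> term) : nat -> term :=
  scons (Var 0) (fun i => tlift (s i)).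

Lemma eq_tsubst s r t : s =1 r -> tsubst s t = tsubst r t.
Proof.
by move=> eq_sr; elim: t => //= [t ->|t -> u ->|t -> u ->].
Qed.

Lemma eq_up s r : s =1 r -> up s =1 up r.
Proof. by move=> eq_sr [|i] //=; rewrite eq_sr. Qed.

Lemma eq_subst s r A : s =1 r -> subst s A = subst r A.
Proof.
elim: A s r => //= [t u|t u|A IA B IB|A IA B IB|A IA B IB|A IA|A IA] s r eq_sr;
  by [rewrite !(eq_tsubst _ eq_sr) | rewrite (IA _ _ eq_sr) (IB _ _ eq_sr)
     | rewrite (IA _ _ (eq_up eq_sr))].
Qed.

Lemma tsubst_tsubst s r t :
  tsubst s (tsubst r t) = tsubst (fun i => tsubst s (r i)) t.
Proof. by elim: t => //= [t ->|t -> u ->|t -> u ->]. Qed.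

Lemma tsubst_up_tlift s t : tsubst (up s) (tlift t) = tlift (tsubst s t).
Proof. by rewrite /tlift !tsubst_tsubst. Qed.

Lemma tsubst_up s r :
  (fun i => tsubst (up s) (up r i)) =1 up (fun i => tsubst s (r i)).
Proof. by case=> [|i] //=; rewrite tsubst_up_tlift. Qed.

Lemma subst_subst s r A :
  subst s (subst r A) = subst (fun i => tsubst s (r i)) A.
Proof.
elim: A s r => //= [t u|t u|A IA B IB|A IA B IB|A IA B IB|A IA|A IA] s r;
  by [rewrite !tsubst_tsubst | rewrite IA IB
     | rewrite IA (eq_subst _ (tsubst_up s r))].
Qed.

Lemma tsubst_var t : tsubst Var t = t.
Proof. by elim: t => //= [t ->|t -> u ->|t -> u ->]. Qed.

Lemma subst_var A : subst Var A = A.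
Proof.
have up_var : up Var =1 Var by case.
elim: A => //= [t u|t u|A -> B ->|A -> B ->|A -> B ->|A IA|A IA] //;
  by [rewrite !tsubst_var | rewrite (eq_subst _ up_var) IA].
Qed.

Lemma inst_tlift t u : tsubst (scons t Var) (tlift u) = u.
Proof. by rewrite tsubst_tsubst tsubst_var. Qed.

Lemma inst_subst_up s A t : inst (subst (up s) A) t = subst (scons t s) A.
Proof.
rewrite /inst subst_subst; apply: eq_subst => -[|i] //=.
by rewrite inst_tlift.
Qed.

Lemma subst_inst s A t :
  subst s (inst A t) = inst (subst (up s) A) (tsubst s t).
Proof.
by rewrite inst_subst_up /inst subst_subst; apply: eq_subst => -[].
Qed.

Lemma lift_subst s A : lift (subst s A) = subst (fun i => tlift (s i)) A.
Proof. exact: subst_subst. Qed.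

Lemma subst_up_lift s A : subst (up s) (lift A) = lift (subst s A).
Proof. by rewrite lift_subst [LHS]subst_subst. Qed.

Lemma inst_up_lift A : inst (subst (up (fun i => Var i.+1)) A) (Var 0) = A.
Proof. by rewrite inst_subst_up -[RHS]subst_var; apply: eq_subst => -[]. Qed.

Lemma iter_lift n A : iter n lift A = subst (fun i => Var (n + i)) A.
Proof. by elim: n => [|n IH]; rewrite ?subst_var //= IH lift_subst. Qed.

Lemma subst_iter_lift n s A :
  (forall i, s (n + i) = Var i) -> subst s (iter n lift A) = A.
Proof.
by move=> sK; rewrite iter_lift subst_subst -[RHS]subst_var; apply: eq_subst.
Qed.

Lemma subst_Imp s A B : subst s (Imp A B) = Imp (subst s A) (subst s B).
Proof. by []. Qed.

Lemma subst_AllLe s t A :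
  subst s (AllLe t A) = AllLe (tsubst s t) (subst (up s) A).
Proof. by rewrite /AllLe /= tsubst_up_tlift. Qed.

Lemma subst_ExLe s t A :
  subst s (ExLe t A) = ExLe (tsubst s t) (subst (up s) A).
Proof. by rewrite /ExLe /= tsubst_up_tlift. Qed.

Lemma subst_AllN s n A : subst s (AllN n A) = AllN n (subst (iter n up s) A).
Proof. by elim: n s => //= n IH s; rewrite IH -iterSr. Qed.

Lemma subst_ExN s n A : subst s (ExN n A) = ExN n (subst (iter n up s) A).
Proof. by elim: n s => //= n IH s; rewrite IH -iterSr. Qed.

Lemma Delta0_subst s A : Delta0 A -> Delta0 (subst s A).
Proof.
move=> dA; elim: dA s => {A} *;
  by rewrite ?subst_AllLe ?subst_ExLe; constructor.
Qed.

Lemma tsubst_numeral s n : tsubst s (numeral n) = numeral n.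
Proof. by elim: n => //= n ->. Qed.

Lemma tlift_numeral n : tlift (numeral n) = numeral n.
Proof. exact: tsubst_numeral. Qed.

Lemma tbounded_numeral k n : tbounded k (numeral n).
Proof. by elim: n. Qed.

Lemma bounded_Imp n A B : bounded n (Imp A B) = bounded n A && bounded n B.
Proof. by []. Qed.

Lemma bounded_AllN k n A : bounded k (AllN n A) = bounded (n + k) A.
Proof. by elim: n k => //= n IH k; rewrite IH addnS. Qed.

Lemma bounded_ExN k n A : bounded k (ExN n A) = bounded (n + k) A.
Proof. by elim: n k => //= n IH k; rewrite IH addnS. Qed.

Lemma eq_tsubst_tbounded n s r t : tbounded n t ->
  (forall i, i < n -> s i = r i) -> tsubst s t = tsubst r t.
Proof.
by move=> + eq_sr; elim: t => //= [t IH /IH ->|t IHt u IHu|t IHt u IHu] //;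
  case/andP=> /IHt -> /IHu ->.
Qed.

Lemma eq_up_below n s r : (forall i, i < n -> s i = r i) ->
  forall i, i < n.+1 -> up s i = up r i.
Proof. by move=> eq_sr [|i] //= /eq_sr ->. Qed.

Lemma eq_subst_bounded n s r A : bounded n A ->
  (forall i, i < n -> s i = r i) -> subst s A = subst r A.
Proof.
elim: A n s r => //= [t u|t u|A IA B IB|A IA B IB|A IA B IB|A IA|A IA] n s r;
  by [case/andP=> bt bu e; rewrite !(eq_tsubst_tbounded _ e)
     | case/andP=> bA bB e; rewrite (IA _ _ _ bA e) (IB _ _ _ bB e)
     | move=> bA e; rewrite (IA _ _ _ bA (eq_up_below e))].
Qed.

Lemma subst_sentence s A : sentence A -> subst s A = A.
Proof. by move=> A0; rewrite -[RHS]subst_var; apply: eq_subst_bounded A0 _. Qed.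

Lemma tbounded_tsubst n s t :
  (forall i, tbounded n (s i)) -> tbounded n (tsubst s t).
Proof. by move=> bs; elim: t => //= t -> u ->. Qed.

Lemma tbounded_tlift n t : tbounded n t -> tbounded n.+1 (tlift t).
Proof. by elim: t => //= t IHt u IHu /andP[/IHt -> /IHu ->]. Qed.

Lemma tbounded_up n s :
  (forall i, tbounded n (s i)) -> forall i, tbounded n.+1 (up s i).
Proof. by move=> bs [|i] //; apply/tbounded_tlift/bs. Qed.

Lemma bounded_subst n s A :
  (forall i, tbounded n (s i)) -> bounded n (subst s A).
Proof.
elim: A n s => //= [t u|t u|A IA B IB|A IA B IB|A IA B IB|A IA|A IA] n s bs;
  by [rewrite !tbounded_tsubst | rewrite IA ?IB | apply/IA/tbounded_up].
Qed.

Lemma tbounded_iter_up k n s :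
  (forall i, tbounded k (s i)) -> forall i, tbounded (n + k) (iter n up s i).
Proof. by move=> bs; elim: n => //= n IH; apply: tbounded_up. Qed.

(* Unlike with [scons _ Var], the variables beyond [ts] become [Zero], a closed
   term: this spares every side condition on the free variables of [A]. *)
Definition inst_seq (A : formula) (ts : seq term) : formula :=
  subst (nth Zero ts) A.
Arguments inst_seq : simpl never.

Lemma tsubst_nth s ts i :
  tsubst s (nth Zero ts i) = nth Zero [seq tsubst s t | t <- ts] i.
Proof. by elim: ts i => [|t ts IH] [|i] /=. Qed.

Lemma subst_inst_seq s A ts :
  subst s (inst_seq A ts) = inst_seq A [seq tsubst s t | t <- ts].
Proof.
by rewrite [LHS]subst_subst; apply: eq_subst => i; apply: tsubst_nth.
Qed.

Lemma inst_inst_seq A t : bounded 1 A -> inst A t = inst_seq A [:: t].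
Proof. by move=> A1; apply: eq_subst_bounded A1 _ => -[]. Qed.

Lemma bounded_inst_seq n A ts :
  all (tbounded n) ts -> bounded n (inst_seq A ts).
Proof.
move=> /(all_nthP Zero) bts; apply: bounded_subst => i.
by case: (ltnP i (size ts)) => [/bts|ge_i] //; rewrite nth_default.
Qed.

(** * Natural deduction over a theory *)

Lemma incl_cons2 (A : formula) G H :
  List.incl G H -> List.incl (A :: G) (A :: H).
Proof. by move=> GH B /= [->|/GH]; auto. Qed.

Lemma nd_weaken G H A : nd G A -> List.incl G H -> nd H A.
Proof.
move=> d; elim: d H => {G A}
  [G A GA|G A _ IH|G A B _ IH|G A B _ IHA _ IHB|G A B _ IHA _ IHB|G A B _ IH
  |G A B _ IH|G A B _ IH|G A B _ IH|G A B C _ IH _ IHA _ IHB|G A _ IH|G A t _ IH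
  |G A t _ IH|G A C _ IHA _ IHC|G t|G A t u _ IHe _ IHA] H GH.
- exact/nd_hyp/GH.
- exact/nd_raa/IH/incl_cons2.
- exact/nd_impI/IH/incl_cons2.
- exact: nd_impE (IHA _ GH) (IHB _ GH).
- exact: nd_andI (IHA _ GH) (IHB _ GH).
- exact: nd_andE1 (IH _ GH).
- exact: nd_andE2 (IH _ GH).
- exact: nd_orI1 (IH _ GH).
- exact: nd_orI2 (IH _ GH).
- exact: nd_orE (IH _ GH) (IHA _ (incl_cons2 GH)) (IHB _ (incl_cons2 GH)).
- exact/nd_allI/IH/List.incl_map.
- exact: nd_allE (IH _ GH).
- exact: nd_exI (IH _ GH).
- exact: nd_exE (IHA _ GH) (IHC _ (incl_cons2 (List.incl_map _ GH))).
- exact: nd_refl.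
- exact: nd_eq (IHe _ GH) (IHA _ GH).
Qed.

Lemma map_subst_up s G :
  map (subst (up s)) (map lift G) = map lift (map (subst s) G).
Proof. by rewrite -!map_comp; apply: eq_map => A /=; apply: subst_up_lift. Qed.

Lemma nd_subst s G A : nd G A -> nd (map (subst s) G) (subst s A).
Proof.
move=> d; elim: d s => {G A}
  [G A GA|G A _ IH|G A B _ IH|G A B _ IHA _ IHB|G A B _ IHA _ IHB|G A B _ IH
  |G A B _ IH|G A B _ IH|G A B _ IH|G A B C _ IH _ IHA _ IHB|G A _ IH|G A t _ IH
  |G A t _ IH|G A C _ IHA _ IHC|G t|G A t u _ IHe _ IHA] s /=.
- exact/nd_hyp/List.in_map.
- exact/nd_raa/IH.
- exact/nd_impI/IH.
- exact: nd_impE (IHA s) (IHB s).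
- exact: nd_andI (IHA s) (IHB s).
- exact: nd_andE1 (IH s).
- exact: nd_andE2 (IH s).
- exact: nd_orI1 (IH s).
- exact: nd_orI2 (IH s).
- exact: nd_orE (IH s) (IHA s) (IHB s).
- by apply: nd_allI; rewrite -map_subst_up; apply: IH.
- by rewrite subst_inst; apply: nd_allE; apply: IH.
- by apply: (nd_exI (t := tsubst s t)); rewrite -subst_inst; apply: IH.
- by apply: nd_exE (IHA s) _; rewrite -map_subst_up -subst_up_lift; apply: IHC.
- exact: nd_refl.
- rewrite subst_inst; apply: nd_eq (IHe s) _.
  by rewrite -subst_inst; apply: IHA.
Qed.

(* [proves T] is [entails T [::]] by conversion. *)
Definition entails (T : theory) (G : seq formula) (A : formula) : Prop :=
  exists H, (forall B, List.In B H -> T B) /\ nd (G ++ H) A.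

Section Entailment.

Variable T : theory.

Lemma entails_weaken G H A : entails T G A -> List.incl G H -> entails T H A.
Proof.
move=> [K [TK d]] GH; exists K; split=> //.
exact: nd_weaken d (List.incl_app_app GH (List.incl_refl K)).
Qed.

Lemma entails_nil G A : entails T [::] A -> entails T G A.
Proof. by move=> d; apply: (@entails_weaken [::]) d (List.incl_nil_l G). Qed.

Lemma entails_cons G A B : entails T G A -> entails T (B :: G) A.
Proof.
by move=> dA; apply: entails_weaken dA (List.incl_tl _ (List.incl_refl _)).
Qed.

Lemma entails_cons2 G A B C :
  entails T (A :: G) C -> entails T (A :: B :: G) C.
Proof.
move=> dC; apply: entails_weaken dC (incl_cons2 _).
exact: List.incl_tl (List.incl_refl _).
Qed.

Lemma entails_head G A : entails T (A :: G) A.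
Proof. by exists [::]; split=> //; apply: nd_hyp; left. Qed.

Lemma entails_unary_rule G1 G A B :
  (forall H, (forall C, List.In C H -> T C) ->
     nd (G1 ++ H) A -> nd (G ++ H) B) ->
  entails T G1 A -> entails T G B.
Proof. by move=> AB [H [TH d]]; exists H; split=> //; apply: AB. Qed.

Lemma entails_binary_rule G1 G2 G A B C :
  (forall H, (forall D, List.In D H -> T D) ->
     nd (G1 ++ H) A -> nd (G2 ++ H) B -> nd (G ++ H) C) ->
  entails T G1 A -> entails T G2 B -> entails T G C.
Proof.
move=> ABC [H [TH dA]] [K [TK dB]]; exists (H ++ K).
have THK D : List.In D (H ++ K) -> T D by move=> /List.in_app_iff [/TH|/TK].
split=> //; apply: ABC => //.
  apply: nd_weaken dA (List.incl_app_app (List.incl_refl _) _).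
  exact: List.incl_appl (List.incl_refl _).
apply: nd_weaken dB (List.incl_app_app (List.incl_refl _) _).
exact: List.incl_appr (List.incl_refl _).
Qed.

Lemma entails_impI G A B : entails T (A :: G) B -> entails T G (Imp A B).
Proof. by apply: entails_unary_rule => H _; apply: nd_impI. Qed.

Lemma entails_impE G A B :
  entails T G (Imp A B) -> entails T G A -> entails T G B.
Proof. by apply: entails_binary_rule => H _; apply: nd_impE. Qed.

Lemma entails_cut G A B :
  entails T G A -> entails T (A :: G) B -> entails T G B.
Proof. by move=> dA /entails_impI dB; apply: entails_impE dB dA. Qed.

Lemma entails_ImpP G A B : entails T G (Imp A B) <-> entails T (A :: G) B.
Proof.
split=> [d|]; last exact: entails_impI.
exact: entails_impE (entails_cons _ d) (entails_head _ _).
Qed.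

Lemma entails_andI G A B :
  entails T G A -> entails T G B -> entails T G (And A B).
Proof. by apply: entails_binary_rule => H _; apply: nd_andI. Qed.

Lemma entails_andE1 G A B : entails T G (And A B) -> entails T G A.
Proof. by apply: entails_unary_rule => H _; apply: nd_andE1. Qed.

Lemma entails_andE2 G A B : entails T G (And A B) -> entails T G B.
Proof. by apply: entails_unary_rule => H _; apply: nd_andE2. Qed.

Lemma entails_IffP A B : entails T [::] (Iff A B) <->
  forall G, entails T G A <-> entails T G B.
Proof.
split=> [dAB G|AB].
  split; apply: entails_impE; apply: entails_nil.
    exact: entails_andE1 dAB.
  exact: entails_andE2 dAB.
by apply: entails_andI; apply/entails_impI/AB/entails_head.
Qed.

Lemma entails_orI1 G A B : entails T G A -> entails T G (Or A B).
Proof. by apply: entails_unary_rule => H _; apply: nd_orI1. Qed.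

Lemma entails_orI2 G A B : entails T G B -> entails T G (Or A B).
Proof. by apply: entails_unary_rule => H _; apply: nd_orI2. Qed.

Lemma entails_orE G A B C : entails T G (Or A B) ->
  entails T (A :: G) C -> entails T (B :: G) C -> entails T G C.
Proof.
move=> dAB /entails_impI dA /entails_impI dB.
apply: entails_impE (entails_impE _ dA) dB.
apply: entails_unary_rule dAB => H _ dAB; do 2!apply: nd_impI.
apply: (@nd_orE _ A B).
- by apply: nd_weaken dAB _; do 2!apply: List.incl_tl; apply: List.incl_refl.
- by apply: (@nd_impE _ A); apply: nd_hyp => /=; auto.
- by apply: (@nd_impE _ B); apply: nd_hyp => /=; auto.
Qed.

Lemma entails_absurd G A : entails T G Bot -> entails T G A.
Proof.
move=> /(entails_cons (Neg A)); apply: entails_unary_rule => H _; exact: nd_raa.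
Qed.

Lemma entails_allE G A t : entails T G (All A) -> entails T G (inst A t).
Proof. by apply: entails_unary_rule => H _; apply: nd_allE. Qed.

Lemma entails_exI G A t : entails T G (inst A t) -> entails T G (Ex A).
Proof. by apply: entails_unary_rule => H _; apply: nd_exI. Qed.

Lemma entails_eq_refl G t : entails T G (Eq t t).
Proof. by exists [::]; split=> //; apply: nd_refl. Qed.

Lemma entails_eq_inst G A t u :
  entails T G (Eq t u) -> entails T G (inst A t) -> entails T G (inst A u).
Proof. by apply: entails_binary_rule => H _; apply: nd_eq. Qed.

Lemma entails_eq_subst_at G A s r k : (forall i, i != k -> s i = r i) ->
  entails T G (Eq (s k) (r k)) ->
  entails T G (subst s A) -> entails T G (subst r A).
Proof.
move=> eq_sr eq_k.
pose hole := subst (fun i => if i == k then Var 0 else tlift (s i)) A.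
have inst_hole t : inst hole t = subst (fun i => if i == k then t else s i) A.
  rewrite /inst subst_subst; apply: eq_subst => i.
  by case: eqP => //= _; apply: inst_tlift.
have eq_s : (fun i => if i == k then s k else s i) =1 s.
  by move=> i; case: eqP => [->|].
have eq_r : (fun i => if i == k then r k else s i) =1 r.
  by move=> i; case: eqP => [->|/eqP /eq_sr].
have := @entails_eq_inst G hole _ _ eq_k.
by rewrite !inst_hole (eq_subst _ eq_s) (eq_subst _ eq_r).
Qed.

Lemma entails_eq_subst n G A s r : (forall i, n <= i -> s i = r i) ->
  (forall i, i < n -> entails T G (Eq (s i) (r i))) ->
  entails T G (subst s A) -> entails T G (subst r A).
Proof.
elim: n s => [|n IH] s eq_ge eq_lt.
  by rewrite (eq_subst _ (fun i => eq_ge i (leq0n i))).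
move=> dA; pose s' i := if i == n then r i else s i.
apply: (IH s') => [i le_ni|i lt_in|].
- by rewrite /s'; case: ltngtP le_ni => // lt_ni _; apply: eq_ge.
- by rewrite /s' (ltn_eqF lt_in); apply/eq_lt/leqW.
apply: (@entails_eq_subst_at _ _ _ _ n) dA => [i /negPf ne_in|].
  by rewrite /s' ne_in.
by rewrite /s' eqxx; apply/eq_lt/leqnn.
Qed.

Lemma entails_eq_inst_seq G A ts us : size ts = size us ->
  (forall i, i < size us -> entails T G (Eq (nth Zero ts i) (nth Zero us i))) ->
  entails T G (inst_seq A ts) -> entails T G (inst_seq A us).
Proof.
move=> eq_size; apply: entails_eq_subst => i le_i.
by rewrite !nth_default ?eq_size.
Qed.

Lemma entails_eq_sym G t u : entails T G (Eq t u) -> entails T G (Eq u t).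
Proof.
move=> eq_tu; have := @entails_eq_inst G (Eq (Var 0) (tlift t)) t u eq_tu.
by rewrite /inst /= !inst_tlift; apply; apply: entails_eq_refl.
Qed.

Lemma entails_eq_trans G t u v :
  entails T G (Eq t u) -> entails T G (Eq u v) -> entails T G (Eq t v).
Proof.
move=> eq_tu eq_uv.
have := @entails_eq_inst G (Eq (tlift t) (Var 0)) u v eq_uv.
by rewrite /inst /= !inst_tlift; apply.
Qed.

Lemma entails_eq_succ G t u :
  entails T G (Eq t u) -> entails T G (Eq (Succ t) (Succ u)).
Proof.
move=> eq_tu.
apply: (@entails_eq_inst_seq G (Eq (Succ (Var 0)) (Succ (Var 1)))
  [:: t; t] [:: t; u]) => //.
  by case=> [|[|//]] // _; apply: entails_eq_refl.
exact: entails_eq_refl.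
Qed.

Lemma entails_eq_add G t t' u u' :
  entails T G (Eq t t') -> entails T G (Eq u u') ->
  entails T G (Eq (Add t u) (Add t' u')).
Proof.
move=> eq_t eq_u.
apply: (@entails_eq_inst_seq G (Eq (Add (Var 0) (Var 1)) (Add (Var 2) (Var 3)))
  [:: t; u; t; u] [:: t; u; t'; u']) => //; last exact: entails_eq_refl.
by case=> [|[|[|[|//]]]] // _; apply: entails_eq_refl.
Qed.

Lemma entails_eq_mul G t t' u u' :
  entails T G (Eq t t') -> entails T G (Eq u u') ->
  entails T G (Eq (Mul t u) (Mul t' u')).
Proof.
move=> eq_t eq_u.
apply: (@entails_eq_inst_seq G (Eq (Mul (Var 0) (Var 1)) (Mul (Var 2) (Var 3)))
  [:: t; u; t; u] [:: t; u; t'; u']) => //; last exact: entails_eq_refl.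
by case=> [|[|[|[|//]]]] // _; apply: entails_eq_refl.
Qed.

Lemma entails_eq_tsubst G s r e : (forall i, entails T G (Eq (s i) (r i))) ->
  entails T G (Eq (tsubst s e) (tsubst r e)).
Proof.
move=> eq_sr; elim: e => //= *;
  by [apply: entails_eq_refl | apply: entails_eq_succ | apply: entails_eq_add
     | apply: entails_eq_mul].
Qed.

Lemma entails_eq_le G t t' u u' :
  entails T G (Eq t t') -> entails T G (Eq u u') ->
  entails T G (Le t u) -> entails T G (Le t' u').
Proof.
move=> eq_t eq_u.
apply: (@entails_eq_inst_seq G (Le (Var 0) (Var 1))
  [:: t; u] [:: t'; u']) => //.
by case=> [|[|//]].
Qed.

End Entailment.

Section TheoryOfSentences.

Variable T : theory.
Hypothesis T_sentence : forall A, T A -> sentence A.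

Lemma map_subst_axioms s H :
  (forall B, List.In B H -> T B) -> map (subst s) H = H.
Proof.
elim: H => //= A H IH TH; rewrite IH => [|B HB]; last by apply: TH; right.
by rewrite subst_sentence //; apply/T_sentence/TH; left.
Qed.

Lemma entails_subst s G A :
  entails T G A -> entails T (map (subst s) G) (subst s A).
Proof.
apply: entails_unary_rule => H TH /(nd_subst s).
by rewrite map_cat (map_subst_axioms s TH).
Qed.

Lemma entails_subst_nil s G A : entails T [::] A -> entails T G (subst s A).
Proof. by move=> /(entails_subst s) /entails_nil. Qed.

Lemma entails_lift G A : entails T G A -> entails T (map lift G) (lift A).
Proof. exact: entails_subst. Qed.

Lemma entails_iter_lift n G A :
  entails T G A -> entails T (map (iter n lift) G) (iter n lift A).
Proof.
move=> /(entails_subst (fun i => Var (n + i))).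
by rewrite iter_lift (eq_map (iter_lift n)).
Qed.

Lemma entails_exE G A C : entails T G (Ex A) ->
  entails T (A :: map lift G) (lift C) -> entails T G C.
Proof.
apply: entails_binary_rule => H TH dA dC; apply: nd_exE dA _.
by rewrite map_cat [map lift H](map_subst_axioms _ TH).
Qed.

Lemma entails_AllP G A : entails T G (All A) <-> entails T (map lift G) A.
Proof.
split=> [/entails_lift /(entails_allE (Var 0))|]; first by rewrite inst_up_lift.
apply: entails_unary_rule => H TH d; apply: nd_allI.
by rewrite map_cat [map lift H](map_subst_axioms _ TH).
Qed.

Lemma entails_AllNP n G A :
  entails T G (AllN n A) <-> entails T (map (iter n lift) G) A.
Proof.
elim: n G => [|n IH] G; first by rewrite map_id.
have -> : map (iter n.+1 lift) G = map (iter n lift) (map lift G).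
  by rewrite -map_comp; apply: eq_map => B; rewrite iterSr.
by rewrite -IH entails_AllP.
Qed.

Lemma entails_AllN_Imp n G A B :
  entails T G (AllN n (Imp (iter n lift A) B)) <->
  entails T (A :: G) (AllN n B).
Proof. by rewrite !entails_AllNP entails_ImpP. Qed.

Lemma entails_Neg_Ex G A :
  entails T G (Neg (Ex A)) <-> entails T G (All (Neg A)).
Proof.
rewrite entails_AllP; split=> [/entails_lift d|d]; apply: entails_impI.
  apply: entails_impE (entails_cons _ d) _; apply: (entails_exI (t := Var 0)).
  by rewrite inst_up_lift; apply: entails_head.
apply: entails_exE (entails_head _ _ _) _; apply/entails_ImpP.
exact: entails_cons.
Qed.

Lemma entails_Neg_ExN n G A :
  entails T G (Neg (ExN n A)) <-> entails T G (AllN n (Neg A)).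
Proof.
elim: n G => [|n IH] G; first by [].
by rewrite /= entails_Neg_Ex !entails_AllP IH.
Qed.

Lemma entails_AllLeI s t G A :
  entails T (Le (Var 0) (tlift (tsubst s t)) :: map lift G) (subst (up s) A) ->
  entails T G (subst s (AllLe t A)).
Proof. by rewrite subst_AllLe => d; apply/entails_AllP/entails_impI. Qed.

Lemma entails_AllLeE s t u G A : entails T G (subst s (AllLe t A)) ->
  entails T G (Le u (tsubst s t)) -> entails T G (subst (scons u s) A).
Proof.
rewrite subst_AllLe => /(entails_allE u).
by rewrite -inst_subst_up /inst /= inst_tlift; apply: entails_impE.
Qed.

Lemma entails_ExLeI s t u G A : entails T G (Le u (tsubst s t)) ->
  entails T G (subst (scons u s) A) -> entails T G (subst s (ExLe t A)).
Proof.
rewrite subst_ExLe -inst_subst_up => le_ut dA; apply: (entails_exI (t := u)).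
by rewrite /inst /= inst_tlift; apply: entails_andI.
Qed.

Lemma entails_Neg_ExLe s t G A : entails T G (subst s (AllLe t (Neg A))) ->
  entails T G (Neg (subst s (ExLe t A))).
Proof.
rewrite subst_AllLe subst_ExLe entails_Neg_Ex !entails_AllP => d.
apply: entails_impI; apply: entails_impE (entails_impE (entails_cons _ d) _) _.
  exact: entails_andE1 (entails_head _ _ _).
exact: entails_andE2 (entails_head _ _ _).
Qed.

End TheoryOfSentences.

(** * The standard model *)

Fixpoint teval (v : nat -> nat) (t : term) : nat :=
  match t with
  | Var i => v i
  | Zero => 0
  | Succ t => (teval v t).+1
  | Add t u => teval v t + teval v u
  | Mul t u => teval v t * teval v u
  end.

Definition vcons (n : nat) (v : nat -> nat) (i : nat) : nat :=
  if i is j.+1 then v j else n.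

Fixpoint sat (v : nat -> nat) (A : formula) : Prop :=
  match A with
  | Bot => False
  | Eq t u => teval v t = teval v u
  | Le t u => teval v t <= teval v u
  | Imp A B => sat v A -> sat v B
  | And A B => sat v A /\ sat v B
  | Or A B => sat v A \/ sat v B
  | All A => forall n, sat (vcons n v) A
  | Ex A => exists n, sat (vcons n v) A
  end.

Lemma eq_teval v w t : v =1 w -> teval v t = teval w t.
Proof. by move=> eq_vw; elim: t => //= [t ->|t -> u ->|t -> u ->]. Qed.

Lemma eq_vcons n v w : v =1 w -> vcons n v =1 vcons n w.
Proof. by move=> eq_vw [|i] //=. Qed.

Lemma eq_sat v w A : v =1 w -> sat v A <-> sat w A.
Proof.
elim: A v w => //= [t u|t u|A IA B IB|A IA B IB|A IA B IB|A IA|A IA] v w eq_vw;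
  try by rewrite ?(eq_teval _ eq_vw) ?(IA _ _ eq_vw) ?(IB _ _ eq_vw).
- by split=> sat_A n; apply/(IA _ _ (eq_vcons n eq_vw)).
- by split=> -[n sat_A]; exists n; apply/(IA _ _ (eq_vcons n eq_vw)).
Qed.

Lemma teval_tsubst v s t :
  teval v (tsubst s t) = teval (fun i => teval v (s i)) t.
Proof. by elim: t => //= [t ->|t -> u ->|t -> u ->]. Qed.

Lemma teval_tlift n v t : teval (vcons n v) (tlift t) = teval v t.
Proof. exact: teval_tsubst. Qed.

Lemma teval_numeral v n : teval v (numeral n) = n.
Proof. by elim: n => //= n ->. Qed.

Lemma teval_up n v s :
  (fun i => teval (vcons n v) (up s i)) =1 vcons n (fun i => teval v (s i)).
Proof. by case=> //= i; rewrite teval_tlift. Qed.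

Lemma sat_subst v s A : sat v (subst s A) <-> sat (fun i => teval v (s i)) A.
Proof.
elim: A v s => //= [t u|t u|A IA B IB|A IA B IB|A IA B IB|A IA|A IA] v s;
  try by rewrite ?teval_tsubst ?IA ?IB.
- by split=> sat_A n; move: (sat_A n); rewrite IA (eq_sat _ (teval_up n v s)).
- by split=> -[n sat_A]; exists n; move: sat_A;
    rewrite IA (eq_sat _ (teval_up n v s)).
Qed.

Lemma sat_inst_seq v A ts :
  sat v (inst_seq A ts) <-> sat (nth 0 [seq teval v t | t <- ts]) A.
Proof.
rewrite sat_subst; apply: eq_sat => i.
by elim: ts i => [|t ts IH] [|i] /=.
Qed.

Lemma sat_And v A B : sat v (And A B) <-> sat v A /\ sat v B.
Proof. by []. Qed.

Lemma sat_Imp v A B : sat v (Imp A B) <-> (sat v A -> sat v B).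
Proof. by []. Qed.

Lemma sat_AllLe v t A :
  sat v (AllLe t A) <-> forall k, k <= teval v t -> sat (vcons k v) A.
Proof. by split=> sat_A k; have /= := sat_A k; rewrite teval_tlift. Qed.

Lemma sat_ExLe v t A :
  sat v (ExLe t A) <-> exists2 k, k <= teval v t & sat (vcons k v) A.
Proof.
split=> [[k /= []]|[k]]; exists k; rewrite /= ?teval_tlift //.
by rewrite -(teval_tlift k).
Qed.

Definition numerals (v : nat -> nat) (i : nat) : term := numeral (v i).

Lemma subst_scons_numerals k v A :
  subst (scons (numeral k) (numerals v)) A = subst (numerals (vcons k v)) A.
Proof. by apply: eq_subst => -[]. Qed.

Lemma inst_seq_numerals A ns :
  inst_seq A (map numeral ns) = subst (numerals (nth 0 ns)) A.
Proof. by apply: eq_subst => i; elim: ns i => [|n ns IH] [|i] //=. Qed.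

(** * Arithmetic in extensions of PA *)

Section Arithmetic.

Variable T : theory.
Hypothesis T_sentence : forall A, T A -> sentence A.
Hypothesis T_PA : extends T PA.

Lemma entails_PA n s G A : PA (AllN n A) -> entails T G (subst s A).
Proof.
move=> PA_A; apply: entails_subst_nil => //.
apply/(entails_AllNP T_sentence n [::])/T_PA.
by exists [:: AllN n A]; split=> [B [<-|//]|] //; apply: nd_hyp; left.
Qed.

Lemma entails_succ_neq0 G t A : entails T G (Eq (Succ t) Zero) -> entails T G A.
Proof.
have := entails_PA (n := 1) (nth Zero [:: t]) G PA_succ_neq0.
by move=> /entails_impE d /d /entails_absurd.
Qed.

Lemma entails_succ_inj G t u :
  entails T G (Eq (Succ t) (Succ u)) -> entails T G (Eq t u).
Proof.
exact: entails_impE (entails_PA (n := 2) (nth Zero [:: u; t]) G PA_succ_inj).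
Qed.

Lemma entails_addn0 G t : entails T G (Eq (Add t Zero) t).
Proof. exact: (entails_PA (n := 1) (nth Zero [:: t]) G PA_add0). Qed.

Lemma entails_addnS G t u : entails T G (Eq (Add t (Succ u)) (Succ (Add t u))).
Proof. exact: (entails_PA (n := 2) (nth Zero [:: u; t]) G PA_addS). Qed.

Lemma entails_muln0 G t : entails T G (Eq (Mul t Zero) Zero).
Proof. exact: (entails_PA (n := 1) (nth Zero [:: t]) G PA_mul0). Qed.

Lemma entails_mulnS G t u : entails T G (Eq (Mul t (Succ u)) (Add (Mul t u) t)).
Proof. exact: (entails_PA (n := 2) (nth Zero [:: u; t]) G PA_mulS). Qed.

Lemma entails_leP G t u : entails T G (Le t u) <->
  entails T G (Ex (Eq (Add (tlift t) (Var 0)) (tlift u))).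
Proof.
move: G; apply/entails_IffP.
exact: (entails_PA (n := 2) (nth Zero [:: u; t]) [::] PA_le).
Qed.

Lemma entails_leI G t u v :
  entails T G (Eq (Add t v) u) -> entails T G (Le t u).
Proof.
move=> eq_u; apply/entails_leP; apply: (entails_exI (t := v)).
by rewrite /inst /= !inst_tlift.
Qed.

Lemma entails_leE G t u C : entails T G (Le t u) ->
  entails T (Eq (Add (tlift t) (Var 0)) (tlift u) :: map lift G) (lift C) ->
  entails T G C.
Proof. by move=> /entails_leP; apply: entails_exE. Qed.

Lemma entails_induction n A : bounded n.+1 A -> entails T [::] (inst A Zero) ->
  entails T [:: A] (subst (scons (Succ (Var 0)) (fun i => Var i.+1)) A) ->
  entails T [::] A.
Proof.
move=> bA base step; have := entails_PA Var [::] (PA_induction bA).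
rewrite subst_var => /entails_impE /(_ base) /entails_impE.
move=> /(_ (iffRL (entails_AllP T_sentence [::] _) (entails_impI step))) dA.
exact/(entails_AllP T_sentence [::]).
Qed.

Lemma entails_zero_or_succ G t :
  entails T G (Or (Eq t Zero) (Ex (Eq (tlift t) (Succ (Var 0))))).
Proof.
apply: (entails_subst_nil T_sentence (nth Zero [:: t]) G
  (A := Or (Eq (Var 0) Zero) (Ex (Eq (Var 1) (Succ (Var 0)))))).
apply: (@entails_induction 0) => //; first exact/entails_orI1/entails_eq_refl.
apply: entails_orI2; apply: (entails_exI (t := Var 0)).
exact: entails_eq_refl.
Qed.

Lemma entails_nat_case G t C : entails T (Eq t Zero :: G) C ->
  entails T (Eq (tlift t) (Succ (Var 0)) :: map lift G) (lift C) ->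
  entails T G C.
Proof.
move=> d0 dS; apply: entails_orE (entails_zero_or_succ G t) d0 _.
apply: (entails_exE T_sentence (entails_head _ _ _)).
exact: entails_cons2.
Qed.

Lemma entails_add0n G t : entails T G (Eq (Add Zero t) t).
Proof.
apply: (entails_subst_nil T_sentence (nth Zero [:: t]) G
  (A := Eq (Add Zero (Var 0)) (Var 0))).
apply: (@entails_induction 0) => //; first exact: entails_addn0.
apply: entails_eq_trans (entails_addnS _ _ _) _.
exact: entails_eq_succ (entails_head _ _ _).
Qed.

Lemma entails_addSn G t u : entails T G (Eq (Add (Succ t) u) (Succ (Add t u))).
Proof.
apply: (entails_subst_nil T_sentence (nth Zero [:: u; t]) G
  (A := Eq (Add (Succ (Var 1)) (Var 0)) (Succ (Add (Var 1) (Var 0))))).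
apply: (@entails_induction 1) => //.
  apply: entails_eq_trans (entails_addn0 _ _) (entails_eq_succ _).
  exact: entails_eq_sym (entails_addn0 _ _).
apply: entails_eq_trans (entails_addnS _ _ _) (entails_eq_succ _).
apply: entails_eq_trans (entails_head _ _ _) _.
exact: entails_eq_sym (entails_addnS _ _ _).
Qed.

Lemma entails_le0n G t : entails T G (Le Zero t).
Proof. exact: entails_leI (entails_add0n _ _). Qed.

Lemma entails_leqW G t u : entails T G (Le t u) -> entails T G (Le t (Succ u)).
Proof.
move=> le_tu; apply: entails_leE le_tu _.
apply: (entails_leI (v := Succ (Var 0))).
apply: entails_eq_trans (entails_addnS _ _ _) _.
exact: entails_eq_succ (entails_head _ _ _).
Qed.

Lemma entails_leSS G t u :
  entails T G (Le (Succ t) (Succ u)) -> entails T G (Le t u).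
Proof.
move=> le_SS; apply: entails_leE le_SS _; apply: (entails_leI (v := Var 0)).
apply: entails_succ_inj; apply: entails_eq_trans (entails_head _ _ _).
exact: entails_eq_sym (entails_addSn _ _ _).
Qed.

Lemma entails_leSn0 G t A : entails T G (Le (Succ t) Zero) -> entails T G A.
Proof.
move=> le_S0; apply: entails_leE le_S0 _.
apply: entails_succ_neq0; apply: entails_eq_trans (entails_head _ _ _).
exact: entails_eq_sym (entails_addSn _ _ _).
Qed.

Lemma entails_le_eqVlt G t u :
  entails T G (Le t u) -> entails T G (Or (Eq t u) (Le (Succ t) u)).
Proof.
move=> le_tu; apply: entails_leE le_tu _.
apply: (entails_nat_case (t := Var 0)).
  apply: entails_orI1.
  apply: entails_eq_trans (entails_eq_sym (entails_addn0 _ _)) _.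
  apply: entails_eq_trans (entails_cons _ (entails_head _ _ _)).
  apply: entails_eq_add (entails_eq_refl _ _ _) _.
  exact: entails_eq_sym (entails_head _ _ _).
apply: entails_orI2; apply: (entails_leI (v := Var 0)).
apply: entails_eq_trans (entails_addSn _ _ _) _.
apply: entails_eq_trans (entails_eq_sym (entails_addnS _ _ _)) _.
apply: entails_eq_trans (entails_cons _ (entails_head _ _ _)).
apply: entails_eq_add (entails_eq_refl _ _ _) _.
exact: entails_eq_sym (entails_head _ _ _).
Qed.

Lemma entails_le_refl G t : entails T G (Le t t).
Proof. exact: entails_leI (entails_addn0 _ _). Qed.

Lemma entails_le_total G t u : entails T G (Or (Le t u) (Le u t)).
Proof.
apply: (entails_subst_nil T_sentence (nth Zero [:: u; t]) G
  (A := Or (Le (Var 1) (Var 0)) (Le (Var 0) (Var 1)))).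
apply: (@entails_induction 1) => //; first exact/entails_orI2/entails_le0n.
apply: entails_orE (entails_head _ _ _) _ _.
  exact/entails_orI1/entails_leqW/entails_head.
apply: entails_orE (entails_le_eqVlt (entails_head _ _ _)) _ _.
  apply/entails_orI1/entails_leqW.
  apply: entails_eq_le (entails_head _ _ _) (entails_eq_refl _ _ _) _.
  exact: entails_le_refl.
exact/entails_orI2/entails_head.
Qed.

Lemma entails_le_cases n G t C : entails T G (Le t (numeral n)) ->
  (forall k, k <= n -> entails T (Eq t (numeral k) :: G) C) -> entails T G C.
Proof.
elim: n G => [|n IH] G le_tn from_eq;
  apply: entails_orE (entails_le_eqVlt le_tn) (from_eq _ (leqnn _)) _.
  exact: entails_leSn0 (entails_head _ _ _).
apply: IH (entails_leSS (entails_head _ _ _)) _ => k le_kn.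
exact: entails_cons2 (from_eq k (leqW le_kn)).
Qed.

Lemma entails_add_numeral G m n :
  entails T G (Eq (Add (numeral m) (numeral n)) (numeral (m + n))).
Proof.
elim: n => [|n IH]; first by rewrite addn0; apply: entails_addn0.
rewrite addnS; apply: entails_eq_trans (entails_addnS _ _ _) _.
exact: entails_eq_succ.
Qed.

Lemma entails_mul_numeral G m n :
  entails T G (Eq (Mul (numeral m) (numeral n)) (numeral (m * n))).
Proof.
elim: n => [|n IH]; first by rewrite muln0; apply: entails_muln0.
rewrite mulnS addnC; apply: entails_eq_trans (entails_mulnS _ _ _) _.
apply: entails_eq_trans (entails_add_numeral _ _ _).
exact: entails_eq_add IH (entails_eq_refl _ _ _).
Qed.

Lemma entails_neq_numeral G m n A : m != n ->
  entails T G (Eq (numeral m) (numeral n)) -> entails T G A.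
Proof.
elim: m n => [|m IH] [|n] //= neq_mn eq_mn.
- exact: entails_succ_neq0 (entails_eq_sym eq_mn).
- exact: entails_succ_neq0 eq_mn.
- exact: IH neq_mn (entails_succ_inj eq_mn).
Qed.

Lemma entails_le_numeral G m n :
  m <= n -> entails T G (Le (numeral m) (numeral n)).
Proof.
move=> le_mn; apply: (entails_leI (v := numeral (n - m))).
by have := entails_add_numeral G m (n - m); rewrite subnKC.
Qed.

Lemma entails_nle_numeral G m n A : n < m ->
  entails T G (Le (numeral m) (numeral n)) -> entails T G A.
Proof.
move=> lt_nm le_mn; apply: entails_le_cases le_mn _ => k le_kn.
apply: entails_neq_numeral (entails_head _ _ _).
by rewrite neq_ltn (leq_ltn_trans le_kn lt_nm) orbT.
Qed.

(** * Decidability of Delta0 formulas *)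

Lemma entails_teval G v t :
  entails T G (Eq (tsubst (numerals v) t) (numeral (teval v t))).
Proof.
elim: t => /= [i||t IH|t IHt u IHu|t IHt u IHu].
- exact: entails_eq_refl.
- exact: entails_eq_refl.
- exact: entails_eq_succ.
- exact: entails_eq_trans (entails_eq_add IHt IHu) (entails_add_numeral _ _ _).
- exact: entails_eq_trans (entails_eq_mul IHt IHu) (entails_mul_numeral _ _ _).
Qed.

Lemma entails_AllLe_numerals v t A :
  (forall k, k <= teval v t ->
     entails T [::] (subst (numerals (vcons k v)) A)) ->
  entails T [::] (subst (numerals v) (AllLe t A)).
Proof.
move=> dA; apply: entails_AllLeI => //.
have le_teval : entails T [:: Le (Var 0) (tlift (tsubst (numerals v) t))]
    (Le (Var 0) (numeral (teval v t))).
  apply: entails_eq_le (entails_eq_refl _ _ _) _ (entails_head _ _ _).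
  have := entails_lift T_sentence (entails_teval [::] v t).
  by rewrite /lift /= tsubst_numeral; apply: entails_cons.
apply: entails_le_cases le_teval _ => k le_k.
apply: (@entails_eq_subst _ 1 _ A (fun i => tlift (numerals (vcons k v) i))).
- by case.
- by case=> // _; rewrite /= tlift_numeral; apply/entails_eq_sym/entails_head.
by rewrite -lift_subst; apply/entails_nil/(entails_lift T_sentence (dA k le_k)).
Qed.

Lemma forall_or_exists_le n (P Q : nat -> Prop) : (forall k, P k \/ Q k) ->
  (forall k, k <= n -> P k) \/ (exists2 k, k <= n & Q k).
Proof.
move=> PQ; elim: n => [|n [allP|[k le_kn Qk]]].
- case: (PQ 0) => [P0|Q0]; [left=> k | by right; exists 0].
  by rewrite leqn0 => /eqP ->.
- case: (PQ n.+1) => [Pn|Qn]; [left=> k | by right; exists n.+1].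
  by rewrite leq_eqVlt => /predU1P[->|/allP].
- by right; exists k => //; apply: leqW.
Qed.

Definition decided (A : formula) (v : nat -> nat) : Prop :=
  (sat v A /\ entails T [::] (subst (numerals v) A)) \/
  (~ sat v A /\ entails T [::] (Neg (subst (numerals v) A))).

Lemma decided_Eq t u v : decided (Eq t u) v.
Proof.
case: (eqVneq (teval v t) (teval v u)) => [eq_tu|neq_tu]; [left|right].
  split=> //=; apply: entails_eq_trans (entails_teval _ _ _) _.
  by rewrite eq_tu; apply/entails_eq_sym/entails_teval.
split=> /=; first exact/eqP.
apply: entails_impI; apply: entails_neq_numeral neq_tu _ => //.
apply: entails_eq_trans (entails_eq_sym (entails_teval _ _ _)) _.
exact: entails_eq_trans (entails_head _ _ _) (entails_teval _ _ _).
Qed.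

Lemma decided_Le t u v : decided (Le t u) v.
Proof.
case: (leqP (teval v t) (teval v u)) => [le_tu|lt_ut]; [left|right].
  split=> //=; apply: entails_eq_le (entails_le_numeral _ le_tu);
    exact/entails_eq_sym/entails_teval.
split=> /=; first by rewrite leqNgt lt_ut.
apply: entails_impI; apply: entails_nle_numeral lt_ut _ => //.
by apply: entails_eq_le (entails_head _ _ _); apply: entails_teval.
Qed.

Lemma decided_Imp A B v : decided A v -> decided B v -> decided (Imp A B) v.
Proof.
move=> [[sA dA]|[nA rA]] [[sB dB]|[nB rB]].
- by left; split=> //=; apply/entails_impI/entails_cons.
- right; split=> /= [/(_ sA)|] //; apply: entails_impI.
  apply: entails_impE (entails_nil _ rB) _.
  exact: entails_impE (entails_head _ _ _) (entails_nil _ dA).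
- by left; split=> //=; apply/entails_impI/entails_cons.
- left; split=> //=; apply/entails_impI/entails_absurd.
  exact: entails_impE (entails_nil _ rA) (entails_head _ _ _).
Qed.

Lemma decided_And A B v : decided A v -> decided B v -> decided (And A B) v.
Proof.
move=> [[sA dA]|[nA rA]].
  move=> [[sB dB]|[nB rB]]; [left|right].
    by split=> //=; apply: entails_andI.
  split=> /= [[]|] //; apply: entails_impI.
  apply: entails_impE (entails_nil _ rB) _.
  exact: entails_andE2 (entails_head _ _ _).
move=> _; right; split=> /= [[]|] //.
apply: entails_impI; apply: entails_impE (entails_nil _ rA) _.
exact: entails_andE1 (entails_head _ _ _).
Qed.

Lemma decided_Or A B v : decided A v -> decided B v -> decided (Or A B) v.
Proof.
move=> [[sA dA]|[nA rA]]; first by left; split; [left|apply: entails_orI1].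
move=> [[sB dB]|[nB rB]]; first by left; split; [right|apply: entails_orI2].
right; split=> /= [[]|] //; apply: entails_impI.
apply: entails_orE (entails_head _ _ _) _ _.
  exact: entails_impE (entails_nil _ rA) (entails_head _ _ _).
exact: entails_impE (entails_nil _ rB) (entails_head _ _ _).
Qed.

Lemma entails_le_teval G v t k : k <= teval v t ->
  entails T G (Le (numeral k) (tsubst (numerals v) t)).
Proof.
move=> /(entails_le_numeral G); apply: entails_eq_le (entails_eq_refl _ _ _) _.
exact/entails_eq_sym/entails_teval.
Qed.

Lemma decided_AllLe t A v :
  (forall k, decided A (vcons k v)) -> decided (AllLe t A) v.
Proof.
move=> /(forall_or_exists_le (teval v t)) [all_A|[k le_kt [nA rA]]].
  left; split; first by apply/sat_AllLe => k /all_A [].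
  by apply: entails_AllLe_numerals => k /all_A [].
right; split=> [/sat_AllLe /(_ k le_kt)|] //.
apply: entails_impI; apply: entails_impE (entails_nil _ rA) _.
rewrite -subst_scons_numerals.
exact: entails_AllLeE (entails_head _ _ _) (entails_le_teval _ le_kt).
Qed.

Lemma decided_ExLe t A v :
  (forall k, decided A (vcons k v)) -> decided (ExLe t A) v.
Proof.
move=> dec_A; have dec_A_sym k := iffLR (or_comm _ _) (dec_A k).
case: (forall_or_exists_le (teval v t) dec_A_sym) => [no_A|].
  right; split=> [/sat_ExLe [k /no_A []]|] //; apply: entails_Neg_ExLe => //.
  by apply: entails_AllLe_numerals => k /no_A [].
case=> k le_kt [sA dA]; left; split; first by apply/sat_ExLe; exists k.
apply: entails_ExLeI (entails_le_teval _ le_kt) _.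
by rewrite subst_scons_numerals.
Qed.

Lemma Delta0_decided A v : Delta0 A -> decided A v.
Proof.
move=> dA; elim: dA v => {A} [|t u|t u|A B _ IA _ IB|A B _ IA _ IB|A B _ IA _ IB
  |t A _ IA|t A _ IA] v.
- by right; split=> //; apply/entails_impI/entails_head.
- exact: decided_Eq.
- exact: decided_Le.
- exact: decided_Imp.
- exact: decided_And.
- exact: decided_Or.
- exact: decided_AllLe.
- exact: decided_ExLe.
Qed.

Lemma Delta0_complete A ns :
  Delta0 A -> sat (nth 0 ns) A -> entails T [::] (inst_seq A (map numeral ns)).
Proof.
move=> dA sA; rewrite inst_seq_numerals.
by case: (Delta0_decided (nth 0 ns) dA) => -[].
Qed.

End Arithmetic.

(** * Iterates as Delta0 formulas *)

Lemma chinese_remainder_seq (m r : nat -> nat) n :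
  (forall i j, i < j < n -> coprime (m j) (m i)) ->
  exists a, forall i, i < n -> a = r i %[mod m i].
Proof.
move=> co_m; pose P k := \prod_(i < k) m i.
elim: n co_m => [|n IH] co_m; first by exists 0.
have [i j /andP[lt_ij lt_jn]|a eq_a] := IH.
  by apply: co_m; rewrite lt_ij ltnW.
have co_P : coprime (P n) (m n).
  apply: (big_ind (coprime^~ (m n))) => [|p q co_p co_q|i _].
  - exact: coprime1n.
  - by rewrite coprimeMl co_p.
  - by rewrite coprime_sym co_m // ltn_ord leqnn.
exists (chinese (P n) (m n) a (r n)) => i.
rewrite ltnS leq_eqVlt => /predU1P[->|lt_in]; first exact: chinese_modr.
have dvd_P : m i %| P n by rewrite /P (bigD1 (Ordinal lt_in)) //= dvdn_mulr.
by rewrite -(modn_dvdm _ dvd_P) chinese_modl // modn_dvdm // eq_a.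
Qed.

Lemma beta_moduli_coprime b i j :
  i < j -> j - i %| b -> coprime (j.+1 * b).+1 (i.+1 * b).+1.
Proof.
move=> lt_ij dvd_b; set d := gcdn (j.+1 * b).+1 (i.+1 * b).+1.
rewrite /coprime -/d -dvdn1.
have d_i : d %| (i.+1 * b).+1 by apply: dvdn_gcdr.
have d_j : d %| (j.+1 * b).+1 by apply: dvdn_gcdl.
have d_ji : d %| j - i.
  have -> : j - i = j.+1 * (i.+1 * b).+1 - i.+1 * (j.+1 * b).+1.
    by rewrite !mulnS !mulnA [j.+1 * i.+1]mulnC subnDr; lia.
  by apply: dvdn_sub; apply: dvdn_mull.
by rewrite -(dvdn_addr 1 (dvdn_mull i.+1 (dvdn_trans d_ji dvd_b))) addn1.
Qed.

Lemma beta_seq (r : nat -> nat) n :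
  exists a b, forall i, i <= n -> a %% (i.+1 * b).+1 = r i.
Proof.
pose M := n + \max_(i < n.+1) r i; pose b := M`!.
have [i j /andP[lt_ij lt_jn]|a eq_a] :=
  @chinese_remainder_seq (fun i => (i.+1 * b).+1) r n.+1.
  by apply: beta_moduli_coprime => //; apply: dvdn_fact; rewrite /M; lia.
exists a, b => i le_in; rewrite (eq_a i) // modn_small // ltnS.
apply: leq_trans (leq_pmull _ _) => //; apply: leq_trans (fact_geq _).
apply: leq_trans (leq_addl _ _).
exact: (leq_bigmax (F := fun i : 'I_n.+1 => r i) (Ordinal (le_in : i < n.+1))).
Qed.

Lemma sat_beta v a b i r : sat v (beta a b i r) <->
  teval v a %% ((teval v i).+1 * teval v b).+1 = teval v r.
Proof.
split=> [/sat_And[le_r /sat_ExLe [q _]]|eq_r].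
  by rewrite /= !teval_tlift => ->; rewrite modnMDl modn_small.
split; first by rewrite /= -eq_r -ltnS ltn_mod.
apply/sat_ExLe; exists (teval v a %/ ((teval v i).+1 * teval v b).+1).
  exact: leq_div.
by rewrite /= !teval_tlift -eq_r -divn_eq.
Qed.

Section IterateGraph.

Variables (z : nat) (p : term).

Let step (r : nat) : nat := teval (fun=> r) p.

(* A sequence coded by [Var 1] and [Var 0] starts at [z], follows [step] for
   [Var 2] steps, and ends at [Var 3]. *)
Definition iterate_seq : formula :=
  And (beta (Var 1) (Var 0) Zero (numeral z))
 (And (AllLe (Var 2) (Imp (Le (Succ (Var 0)) (Var 3))
         (ExLe (Var 2)
           (And (beta (Var 3) (Var 2) (Var 1) (Var 0))
                (beta (Var 3) (Var 2) (Succ (Var 1))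
                      (tsubst (fun=> Var 0) p))))))
      (beta (Var 1) (Var 0) (Var 2) (Var 3))).

Lemma sat_iterate_seq v : sat v iterate_seq <->
  let e i := v 1 %% (i.+1 * v 0).+1 in
  [/\ e 0 = z, forall i, i < v 2 -> e i.+1 = step (e i) & e (v 2) = v 3].
Proof.
have stepE w : teval w (tsubst (fun=> Var 0) p) = step (w 0).
  exact: teval_tsubst.
split=> [/sat_And[/sat_beta e0 /sat_And[/sat_AllLe es /sat_beta en]]|].
  rewrite teval_numeral in e0; split=> // i lt_i.
  have /sat_ExLe [r _ /sat_And[/sat_beta ei /sat_beta ei1]] :=
    iffLR (sat_Imp _ _ _) (es i (ltnW lt_i)) lt_i.
  by move: ei ei1; rewrite stepE /= => <-.
move=> [e0 es en].
apply/sat_And; split; first by apply/sat_beta; rewrite teval_numeral.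
apply/sat_And; split; last exact/sat_beta.
apply/sat_AllLe => i _; apply/sat_Imp => lt_i; apply/sat_ExLe.
exists (v 1 %% (i.+1 * v 0).+1); first exact: leq_mod.
by apply/sat_And; split; apply/sat_beta; rewrite // stepE /= es.
Qed.

(* [Var 1] is the iterate of index [Var 0], as witnessed by a sequence whose
   code is bounded by [Var 2]. *)
Definition iterate_graph : formula := ExLe (Var 2) (ExLe (Var 3) iterate_seq).

Lemma Delta0_iterate_graph : Delta0 iterate_graph.
Proof. by do !constructor. Qed.

Lemma sat_iterate_graph x u c :
  sat (nth 0 [:: x; u; c]) iterate_graph -> u = iter x step z.
Proof.
move=> /sat_ExLe [a _ /sat_ExLe [b _ /sat_iterate_seq /= [e0 es <-]]].
by elim: x es => //= x IH es; rewrite es // IH // => i lt_i; apply/es/leqW.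
Qed.

Lemma iterate_graph_witness x : exists2 c, iter x step z <= c &
  sat (nth 0 [:: x; iter x step z; c]) iterate_graph.
Proof.
have [a [b eq_ab]] := beta_seq (fun i => iter i step z) x.
exists (iter x step z + a + b); first by rewrite -addnA leq_addr.
apply/sat_ExLe; exists a; first by rewrite /= addnAC leq_addl.
apply/sat_ExLe; exists b; first exact: leq_addl.
by apply/sat_iterate_seq; split=> /= [|i lt_i|]; rewrite ?eq_ab // ltnW.
Qed.

End IterateGraph.

(** * Representing functions *)

Definition no_rival (W : formula) : formula :=
  AllLe (Var 2) (AllLe (Var 3)
    (Imp (inst_seq W [:: Var 2; Var 0; Var 1]) (Eq (Var 0) (Var 3)))).

(* In the manner of Rosser: the value [Var 1] of the function at [Var 0] comes
   with a witness [Var 2] below which no rival value has a witness. This makes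
   the uniqueness of the value a matter of deciding finitely many Delta0
   sentences, instead of proving in PA that [W] is functional. *)
Definition rosser (W : formula) : formula :=
  And (Le (Var 1) (Var 2))
      (And (inst_seq W [:: Var 0; Var 1; Var 2]) (no_rival W)).

Lemma inst_seq_rosser W x u w : inst_seq (rosser W) [:: x; u; w] =
  And (Le u w)
      (And (inst_seq W [:: x; u; w])
           (subst (nth Zero [:: x; u; w]) (no_rival W))).
Proof.
by rewrite -(subst_inst_seq (nth Zero [:: x; u; w]) W [:: Var 0; Var 1; Var 2]).
Qed.

Lemma Delta0_rosser W : Delta0 W -> Delta0 (rosser W).
Proof. by move=> dW; do !constructor; apply: Delta0_subst. Qed.

Definition represents (T : theory) (R : formula) (f : nat -> nat) : Prop :=
  (forall x, exists w,
     entails T [::] (inst_seq R [:: numeral x; numeral (f x); numeral w])) /\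
  (forall G x u w, entails T G (inst_seq R [:: numeral x; u; w]) ->
     entails T G (Eq u (numeral (f x)))).

Section Representability.

Variable T : theory.
Hypothesis T_sentence : forall A, T A -> sentence A.
Hypothesis T_PA : extends T PA.

Variables (f : nat -> nat) (W : formula).
Hypothesis W_Delta0 : Delta0 W.
Hypothesis W_sound : forall x u c, sat (nth 0 [:: x; u; c]) W -> u = f x.
Hypothesis W_witness :
  forall x, exists2 c, f x <= c & sat (nth 0 [:: x; f x; c]) W.

Lemma entails_rosser_value x : exists w,
  entails T [::] (inst_seq (rosser W) [:: numeral x; numeral (f x); numeral w]).
Proof.
have [w le_w sat_W] := W_witness x; exists w.
apply: (Delta0_complete T_sentence T_PA (ns := [:: x; f x; w])).
  exact: Delta0_rosser.
apply/sat_And; split=> //; apply/sat_And; split; first exact/sat_inst_seq.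
apply/sat_AllLe => w' _; apply/sat_AllLe => u' _; apply/sat_Imp.
by move=> /sat_inst_seq /W_sound.
Qed.

Lemma entails_rosser_rival G x u w u' w' :
  entails T G (inst_seq (rosser W) [:: x; u; w]) ->
  entails T G (Le w' w) -> entails T G (Le u' w) ->
  entails T G (inst_seq W [:: x; u'; w']) -> entails T G (Eq u' u).
Proof.
rewrite inst_seq_rosser /no_rival.
move=> /entails_andE2 /entails_andE2 d le_w' le_u' dW.
have := entails_AllLeE (entails_AllLeE d le_w') le_u'.
by rewrite subst_Imp subst_inst_seq => /entails_impE; apply.
Qed.

Lemma entails_witness_sound G x u c :
  entails T G (inst_seq W (map numeral [:: x; u; c])) ->
  entails T G (Eq (numeral u) (numeral (f x))).
Proof.
rewrite inst_seq_numerals => dW.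
case: (Delta0_decided T_sentence T_PA (nth 0 [:: x; u; c]) W_Delta0) => -[].
  by move=> /W_sound -> _; apply: entails_eq_refl.
move=> _ rW; apply: entails_absurd.
exact: entails_impE (entails_nil _ rW) dW.
Qed.

Lemma entails_bounded_witness_sound n G x u w :
  entails T G (Le w (numeral n)) -> entails T G (Le u w) ->
  entails T G (inst_seq W [:: numeral x; u; w]) ->
  entails T G (Eq u (numeral (f x))).
Proof.
move=> le_wn le_uw dW; apply: entails_le_cases le_wn _ => // k _.
have le_uk : entails T (Eq w (numeral k) :: G) (Le u (numeral k)).
  apply: entails_eq_le (entails_eq_refl _ _ _) (entails_head _ _ _) _.
  exact: entails_cons.
apply: entails_le_cases le_uk _ => // j _.
apply: entails_eq_trans (entails_head _ _ _) _.
apply: (@entails_witness_sound _ x j k).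
apply: entails_eq_inst_seq (entails_cons _ (entails_cons _ dW)) => //.
case=> [|[|[|//]]] _; first exact: entails_eq_refl.
  exact: entails_head.
exact/entails_cons/entails_head.
Qed.

Lemma entails_rosser_unique G x u w :
  entails T G (inst_seq (rosser W) [:: numeral x; u; w]) ->
  entails T G (Eq u (numeral (f x))).
Proof.
move=> d; have := d; rewrite inst_seq_rosser => d_and.
have le_uw := entails_andE1 d_and.
have dW := entails_andE1 (entails_andE2 d_and).
have below n : entails T (Le w (numeral n) :: G) (Eq u (numeral (f x))).
  apply: entails_bounded_witness_sound (entails_head _ _ _) _ _;
    exact: entails_cons.
have [c le_c sat_W] := W_witness x.
apply: entails_orE (entails_le_total _ _ G w (numeral c)) (below c) _ => //.
apply: entails_orE (entails_le_total _ _ _ w (numeral (f x))) _ _ => //.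
  exact: entails_cons2.
apply/entails_eq_sym/(entails_rosser_rival (entails_cons _ (entails_cons _ d))).
- exact/entails_cons/entails_head.
- exact: entails_head.
- exact/entails_nil/(Delta0_complete T_sentence T_PA W_Delta0 sat_W).
Qed.

Lemma rosser_represents : represents T (rosser W) f.
Proof.
by split; [apply: entails_rosser_value|apply: entails_rosser_unique].
Qed.

End Representability.

(** * Fixed points of Pi1 formulas *)

Lemma tgn_numeral_representable T : (forall A, T A -> sentence A) ->
  extends T PA ->
  exists R, Delta0 R /\ represents T R (fun x => tgn (numeral x)).
Proof.
move=> T_sentence T_PA; pose p := tpair (numeral 2) (Var 0).
have tgn_numeral x :
    iter x (fun r => teval (fun=> r) p) (tgn Zero) = tgn (numeral x).
  by elim: x => //= x ->.
exists (rosser (iterate_graph (tgn Zero) p)); split.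
  exact/Delta0_rosser/Delta0_iterate_graph.
apply: rosser_represents => // [|x u c|x]; rewrite -?tgn_numeral.
- exact: Delta0_iterate_graph.
- exact: sat_iterate_graph.
- exact: iterate_graph_witness.
Qed.

Lemma gn_AllN n A : gn (AllN n A) = iter n (pairn 6) (gn A).
Proof. by elim: n => //= n ->. Qed.

(* The Goedel number of [diag_sentence] below as a polynomial in the Goedel
   number [Var 0] of [diag_body] and that of its numeral, [Var 1]. *)
Definition diag_code (n : nat) : term :=
  iter n.+3 (tpair (numeral 6)) (tpair (numeral 3)
    (tpair (tpair (numeral 1) (tpair (numeral (tgn (Var (n + 2)))) (Var 1)))
           (Var 0))).

Lemma teval_diag_code n g A :
  teval (nth 0 [:: gn A; tgn (numeral g)]) (diag_code n) =
  gn (AllN n.+3 (Imp (Eq (Var (n + 2)) (numeral g)) A)).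
Proof.
have tevalE v t u : teval v (tpair t u) = pairn (teval v t) (teval v u) by [].
rewrite gn_AllN /diag_code; elim: n.+3 => [|k IH].
  by rewrite !tevalE !teval_numeral.
by rewrite !iterS tevalE IH.
Qed.

Section FixedPoint.

Variable T : theory.
Hypothesis T_sentence : forall A, T A -> sentence A.
Hypothesis T_PA : extends T PA.

Variable R : formula.
Hypothesis R_Delta0 : Delta0 R.
Hypothesis R_represents : represents T R (fun x => tgn (numeral x)).

Variables (n : nat) (A : formula).
Hypothesis A_bounded : bounded n.+1 A.

Definition diag_body : formula :=
  Imp (iter n lift (inst_seq R [:: Var 2; Var 1; Var 0]))
      (subst (iter n up
         (nth Zero [:: tsubst (nth Zero [:: Var 2; Var 1]) (diag_code n)])) A).

(* Smullyan's trick: prefixing [x = numeral g] rather than substituting the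
   numeral of [g] makes the code of the result a polynomial in [g] and the code
   of that numeral. *)
Definition diag_matrix : formula :=
  Imp (Eq (Var (n + 2)) (numeral (gn diag_body))) diag_body.

Definition diag_sentence : formula := AllN n.+3 diag_matrix.

Lemma Delta0_diag_matrix : Delta0 A -> Delta0 diag_matrix.
Proof.
move=> dA; do 2!constructor; last exact: Delta0_subst.
by rewrite iter_lift; do 2!apply: Delta0_subst.
Qed.

Lemma bounded_diag_matrix : bounded n.+3 diag_matrix.
Proof.
rewrite /diag_matrix; move: (gn diag_body) => g.
have bounded_var i : i < 3 -> n + i < n.+3 by lia.
rewrite /diag_body iter_lift subst_inst_seq !bounded_Imp; apply/and3P; split.
- by rewrite /= bounded_var // tbounded_numeral.
- by rewrite bounded_inst_seq //= !bounded_var.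
- apply: bounded_subst; rewrite -addn3; apply: tbounded_iter_up => -[|[|]] //.
  by apply: tbounded_tsubst => -[|[|[]]].
Qed.

Lemma entails_diag_sentence G : entails T G diag_sentence <->
  entails T [:: inst_seq R [:: Var 2; Var 1; Var 0],
                Eq (Var 2) (numeral (gn diag_body)) & map (iter 3 lift) G]
    (inst_seq (AllN n A)
       [:: tsubst (nth Zero [:: Var 2; Var 1]) (diag_code n)]).
Proof.
have eqE : Eq (Var (n + 2)) (numeral (gn diag_body)) =
    iter n lift (Eq (Var 2) (numeral (gn diag_body))).
  by rewrite iter_lift /= tsubst_numeral.
rewrite /diag_sentence -[n.+3]/(3 + n) /AllN iterD -/(AllN n _) -/(AllN 3 _).
rewrite entails_AllNP // /diag_matrix eqE !entails_AllN_Imp //.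
by rewrite /inst_seq subst_AllN.
Qed.

Lemma entails_diag_code G x u : entails T G (Eq x (numeral (gn diag_body))) ->
  entails T G (Eq u (numeral (tgn (numeral (gn diag_body))))) ->
  entails T G
    (Eq (tsubst (nth Zero [:: x; u]) (diag_code n)) (quote diag_sentence)).
Proof.
move=> eq_x eq_u; rewrite /quote /diag_sentence /diag_matrix -teval_diag_code.
apply: entails_eq_trans (entails_teval T_sentence T_PA _ _ _).
apply: entails_eq_tsubst => -[|[|i]] //=.
by rewrite /numerals /= !nth_nil; apply: entails_eq_refl.
Qed.

Lemma entails_diag_sentence_elim G : entails T G diag_sentence ->
  entails T G (inst (AllN n A) (quote diag_sentence)).
Proof.
rewrite entails_diag_sentence inst_inst_seq ?bounded_AllN ?addn1 // => d.
have := entails_diag_code (entails_eq_refl T G _) (entails_eq_refl T G _).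
move: (quote diag_sentence) (gn diag_body) (diag_code n) d => q g e d eq_q.
have [w dw] := R_represents.1 g; set u := numeral (tgn _) in dw eq_q.
have := entails_subst T_sentence
  (scons (numeral w) (scons u (scons (numeral g) Var))) d.
rewrite /= !subst_inst_seq /= tsubst_numeral tsubst_tsubst.
rewrite (eq_tsubst _ (tsubst_nth _ _)) -map_comp.
rewrite (eq_map (g := id)) /= => [|B]; last exact: subst_iter_lift.
rewrite map_id => /(entails_cut (entails_nil _ dw)).
move=> /(entails_cut (entails_eq_refl _ _ _)) {}d.
by apply: entails_eq_inst_seq d => // -[].
Qed.

Lemma entails_diag_sentence_intro G :
  entails T G (inst (AllN n A) (quote diag_sentence)) ->
  entails T G diag_sentence.
Proof.
rewrite entails_diag_sentence inst_inst_seq ?bounded_AllN ?addn1 // => d.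
have liftK k : iter 3 lift (inst_seq (AllN n A) [:: numeral k]) =
    inst_seq (AllN n A) [:: numeral k].
  by rewrite iter_lift subst_inst_seq /= tsubst_numeral.
have := entails_iter_lift T_sentence 3 d; rewrite liftK => {}d.
set ctx := [:: _, _ & _].
have eq_x : entails T ctx (Eq (Var 2) (numeral (gn diag_body))).
  exact/entails_cons/entails_head.
have eq_u : entails T ctx (Eq (Var 1) (numeral (tgn (numeral (gn diag_body))))).
  apply: (R_represents.2 _ _ _ (Var 0)).
  apply: entails_eq_inst_seq (entails_head _ _ _) => // -[|[|[|//]]] //= _;
    exact: entails_eq_refl.
have eq_q := entails_eq_sym (entails_diag_code eq_x eq_u).
apply: entails_eq_inst_seq (entails_cons _ (entails_cons _ d)) => //.
by case.
Qed.

End FixedPoint.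

Lemma Pi1_fixed_point T n A : (forall B, T B -> sentence B) -> extends T PA ->
  Delta0 A -> bounded n.+1 A -> exists m M,
  [/\ bounded m M, Delta0 M &
      proves T (Iff (AllN m M) (inst (AllN n A) (quote (AllN m M))))].
Proof.
move=> T_sentence T_PA A_Delta0 A_bounded.
have [R [R_Delta0 R_represents]] := tgn_numeral_representable T_sentence T_PA.
exists n.+3, (diag_matrix R n A); split.
- exact: bounded_diag_matrix.
- exact: Delta0_diag_matrix.
- apply/(entails_IffP T) => G; split.
    exact: entails_diag_sentence_elim.
  exact: entails_diag_sentence_intro.
Qed.

Lemma Sigma1_Neg_fixed_point T Pr : (forall A, T A -> sentence A) ->
  extends T PA -> Sigma1 Pr -> bounded 1 Pr -> exists n A,
  [/\ bounded n A, Delta0 A &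
      proves T (Iff (AllN n A) (Neg (inst Pr (quote (AllN n A)))))].
Proof.
move=> T_sentence T_PA [n [B [dB ->]]]; rewrite bounded_ExN addn1 => bB.
have [||m [M [bM dM fixM]]] :=
  Pi1_fixed_point T_sentence T_PA (n := n) (A := Neg B).
- by constructor=> //; constructor.
- by rewrite bounded_Imp bB.
exists m, M; split=> //; move: (quote _) fixM => q /(entails_IffP T) fixM.
apply/(entails_IffP T) => G; rewrite fixM /inst subst_AllN subst_ExN.
by rewrite entails_Neg_ExN.
Qed.

Lemma CB_RFN_reflection S T Pr n A : (forall B, T B -> sentence B) ->
  extends T S -> CB S Pr -> bounded n A ->
  proves T (AllN n (Imp (at_dot Pr n A) A)) ->
  proves T (Imp (inst Pr (quote (AllN n A))) (AllN n A)).
Proof.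
move=> T_sentence T_S S_CB A_bounded rfn; apply: (@entails_impI T [::]).
apply/entails_AllNP => //; apply: entails_impE.
  exact: (iffLR (entails_AllNP T_sentence n _ _) (entails_nil _ rfn)).
apply/entails_AllNP => //; apply: entails_impE (entails_head _ _ _).
exact/entails_nil/T_S/S_CB.
Qed.

Theorem proposition3p9 (S T : theory) (Pr : formula)
  (hS : consistent_ce_extension_of_PA S)
  (hT : consistent_ce_extension_of_PA T)
  (hST : extends T S)
  (hPr : provability_predicate S T Pr)
  (hSigma1 : Sigma1 Pr)
  (hCB : CB S Pr) :
  exists C : formula, RFN_Delta0 Pr C /\ ~ proves T C.
Proof.
have [T_sentence T_consistent _ T_PA] := hT; have [Pr_bounded PrP] := hPr.
have [n [A [A_bounded A_Delta0 fixA]]] :=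
  Sigma1_Neg_fixed_point T_sentence T_PA hSigma1 Pr_bounded.
exists (AllN n (Imp (at_dot Pr n A) A)); split; first by exists n, A.
move=> /(CB_RFN_reflection T_sentence hST hCB A_bounded) reflA.
move: fixA => /(entails_IffP T) fixA; set P := inst Pr _ in fixA reflA.
have notP : entails T [::] (Neg P).
  apply: entails_impI; apply: entails_impE (entails_head _ _ _).
  exact/fixA/entails_ImpP.
have provesA : proves T (AllN n A) by apply/(fixA [::]).
exact: T_consistent (entails_impE notP (hST _ (iffLR (PrP _) provesA))).
Qed.
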